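(* Let $\boldsymbol{a}\in\mathbb{C}^n$ be a random vector with independent mean-zero, variance-one entries $\{a_i\}_{i=1}^n$. Fix $p\ge2$, and assume that $\alpha_{2p}=\max_i\mathbb{E}\left[|a_i|^{2p}\right]<\infty$. Then for any $\boldsymbol{M}\in\mathbb{C}^{n\times n}$, $$\mathbb{E}\,|\boldsymbol{a}^*\boldsymbol{M}\boldsymbol{a}|^p\le C_p\left(|\operatorname{Tr}(\boldsymbol{M})|^p+\alpha_{2p}\|\boldsymbol{M}\|_F^p\right),$$ where $C_p$ is a constant depending only on $p$.
   Context: $\|\cdot\|_F$ is the Frobenius norm. ''Mean-zero, variance-one'' means $\mathbb{E}[a_i]=0$ and $\mathbb{E}[|a_i|^2]=1$. *)

(* Defs.v *)
From HB Require Import structures.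
From mathcomp Require Import all_boot all_order all_algebra.
From mathcomp Require Import all_classical all_reals all_analysis.
From mathcomp Require Import complex.

Set Implicit Arguments.
Unset Strict Implicit.
Unset Printing Implicit Defensive.

Import Order.TTheory GRing.Theory Num.Theory.
Import numFieldNormedType.Exports.
Import Normc.

Local Open Scope classical_set_scope.
Local Open Scope ring_scope.

(* R[i] carries no sigma-algebra in the libraries. Its Borel sets are those of
   the plane: a complex random variable X is measured through the pair
   (Re X, Im X), R * R having the product of the Borel sigma-algebras. *)
Definition plane (R : realType) (z : R[i]) :
  (measurableTypeR R * measurableTypeR R)%type := (complex.Re z, complex.Im z).

Definition complex_rv (R : realType) (d : measure_display)
    (T : measurableType d) (X : T -> R[i]) : Prop :=
  measurable_fun [set: T] (fun w => plane (X w)).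

(* Only meaningful when Re X and Im X are integrable: [fine] sends an infinite
   expectation to 0. A finite second absolute moment is enough. *)
Definition cexpectation (R : realType) (d : measure_display)
    (T : measurableType d) (P : probability T R) (X : T -> R[i]) : R[i] :=
  (fine 'E_P[fun w => complex.Re (X w)] +i*
   fine 'E_P[fun w => complex.Im (X w)])%C.

Definition abs_moment (R : realType) (d : measure_display)
    (T : measurableType d) (P : probability T R) (X : T -> R[i]) (q : R) :
    \bar R :=
  'E_P[fun w => normc (X w) `^ q].

Definition independent_crvs (R : realType) (d : measure_display)
    (T : measurableType d) (P : probability T R) (I : finType)
    (X : I -> T -> R[i]) : Prop :=
  forall (J : {set I}) (B : I -> set (measurableTypeR R * measurableTypeR R)),
    (forall i, measurable (B i)) ->
    P (\bigcap_(i in [set` J]) ((fun w => plane (X i w)) @^-1` B i)) =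
    (\prod_(i in J) P ((fun w => plane (X i w)) @^-1` B i))%E.

(* The base value 0 is harmless: the moments are nonnegative. *)
Definition max_abs_moment (R : realType) (d : measure_display)
    (T : measurableType d) (P : probability T R) (n : nat)
    (a : T -> 'cV[R[i]]_n) (q : R) : \bar R :=
  (\big[maxe/0]_(i < n) abs_moment P (fun w => a w i ord0) q)%E.

Definition frobenius_norm (R : realType) (m n : nat) (M : 'M[R[i]]_(m, n)) : R :=
  Num.sqrt (\sum_(i < m) \sum_(j < n) normc (M i j) ^+ 2).

(* a^* M a, the only entry of a 1 x 1 matrix *)
Definition quad_form (R : realType) (n : nat) (M : 'M[R[i]]_n)
    (a : 'cV[R[i]]_n) : R[i] :=
  (map_mx Num.conj a^T *m M *m a) ord0 ord0.

(* Main.v *)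
From HB Require Import structures.
Require Import Defs.
From mathcomp Require Import all_boot all_order all_algebra.
From mathcomp Require Import all_classical all_reals all_analysis.
From mathcomp Require Import measurable_realfun complex ring lra.
Set Implicit Arguments.
Unset Strict Implicit.
Unset Printing Implicit Defensive.
Import Order.TTheory GRing.Theory Num.Theory.
Import numFieldNormedType.Exports.
Import Normc.
Local Open Scope classical_set_scope.
Local Open Scope ring_scope.

(** The proof replaces the usual Burkholder and Rosenthal inequalities by one
    two-point inequality, the 2-smoothness of L^p for [p >= 2]: if
    [E(X |X|^(p-2) Y) = 0], then
    [||X + Y||_p^2 <= ||X||_p^2 + K_p ||Y||_p^2] ([smooth_step]). Because the
    coefficient of [||X||_p^2] is exactly 1, the inequality can be iterated:
    the squared p-norm of a sum of martingale differences is at most [K_p]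
    times the sum of their squared p-norms ([martingale_moment]).

    Write [a_i = x_i + i y_i]. The real part of [a^* M a - Tr M] is a sum over
    [k] of the differences
    [D_k = Re(M_kk) (|a_k|^2 - 1) + x_k U_k + y_k V_k], where [U_k] and [V_k]
    are linear forms in the [a_j] with [j < k]. Each of the three factors that
    depend on [a_k] is centered and independent of the past, so the martingale
    inequality applies to the [D_k]. It also applies to [U_k] and [V_k], which
    are sums of independent centered terms. With [g^p = alpha_2p] one has
    [E|a_k|^2p <= g^p] and [E|a_k|^p <= g^(p/2)], and independence gives
    [||x_k U_k||_p^2 <= g ||U_k||_p^2]. Hence the squared p-norm of [D_k] is at
    most a constant times [g^2] times the sum of the [|M_ij|^2] with
    [max(i, j) = k]. Summing over [k] yields
    [E|Re(a^* M a - Tr M)|^p <= C (g^2 ||M||_F^2)^(p/2)], and the right-hand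
    side is [C alpha_2p ||M||_F^p] ([quadratic_chaos]). The imaginary part is
    the real part for the matrix [- i M].

    Independence enters only through products of a function of the past and a
    function of [a_k]. The sigma-algebra of the past is generated by a
    pi-system of boxes, on which independence of the family is a product
    formula; the pi-lambda theorem extends it to all past events
    ([past_indep]) and Fubini's theorem turns it into a product formula for
    expectations ([indep2_integral_norm], [indep2_integral_centered]). *)

(** * Real inequalities between powers *)

Section pointwise.
Context {R : realType}.
Implicit Types (x y u v a b c q r : R).

Lemma ler_powRl u v r : 0 <= r -> 0 <= u -> u <= v -> u `^ r <= v `^ r.
Proof.
move=> r0 u0 uv; apply: ge0_ler_powR => //; rewrite nnegrE //.
exact: le_trans uv.
Qed.

(** This is Young's inequality for [u] and [v^(q-1)]; it says that the convex
    function [t^q] lies above its tangent at [v]. *)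
Lemma powR_tangent u v q : 1 <= q -> 0 <= u -> 0 <= v ->
  v `^ q + q * v `^ (q - 1) * (u - v) <= u `^ q.
Proof.
rewrite le_eqVlt => /predU1P[<-|q1] u0 v0.
  by rewrite subrr powRr0 !powRr1// !mul1r addrC subrK.
have q0 : 0 < q by lra.
have vq : v `^ q = v `^ (q - 1) * v.
  by rewrite mulrC mulr_powRB1.
have q10 : 0 < q - 1 by lra.
have qn0 : q != 0 by lra.
have qm0 : q - 1 != 0 by lra.
have := @conjugate_powR _ u (v `^ (q - 1)) q (q / (q - 1)) u0 (powR_ge0 _ _) q0.
move=> /(_ (divr_gt0 q0 q10)).
have -> : q^-1 + (q / (q - 1))^-1 = 1 by field; rewrite ?qn0 ?qm0.
move=> /(_ erefl).
rewrite -powRrM mulrC.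
have -> : (q - 1) * (q / (q - 1)) = q by field.
have -> : v `^ q / (q / (q - 1)) = v `^ q - v `^ q / q by field; rewrite ?qn0 ?qm0.
move=> H.
have {}H : q * (v `^ (q - 1) * u) <=
    q * (u `^ q / q + (v `^ q - v `^ q / q)) by rewrite ler_pM2l.
have E : q * (u `^ q / q + (v `^ q - v `^ q / q)) =
    u `^ q + q * v `^ q - v `^ q by field.
rewrite E vq in H; rewrite vq; lra.
Qed.

(** Up to a factor, the derivative of [|x|^(r+2)]. *)
Definition spow r x := x * `|x| `^ r.

Lemma norm_spow r x : 0 <= r -> `|spow r x| = `|x| `^ (r + 1).
Proof.
move=> r0; rewrite /spow normrM (ger0_norm (powR_ge0 _ _)).
have := @mulr_powRB1 _ `|x| (r + 1) (normr_ge0 x); rewrite addrK; apply; lra.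
Qed.

Lemma powR_norm_tangent x y p : 2 <= p ->
  `|y| `^ p + p * spow (p - 2) y * (x - y) <= `|x| `^ p.
Proof.
move=> p2.
have := @powR_tangent `|x| `|y| p _ (normr_ge0 _) (normr_ge0 _).
move=> /(_ ltac:(lra)); apply: le_trans.
have A : spow (p - 2) y * x <= `|y| `^ (p - 1) * `|x|.
  apply: (le_trans (ler_norm _)); rewrite normrM norm_spow; last lra.
  by have -> : p - 2 + 1 = p - 1 by ring.
have B : spow (p - 2) y * y = `|y| `^ (p - 1) * `|y|.
  have E : `|y| * `|y| = y * y by rewrite -!expr2 real_normK// num_real.
  rewrite /spow [LHS]mulrAC -E -mulrA.
  rewrite -[in RHS](@mulr_powRB1 _ `|y| (p - 1))//; last lra.
  have -> : p - 1 - 1 = p - 2 by ring.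
  ring.
rewrite lerD2l -(mulrA p) -(mulrA p) ler_pM2l; last lra.
by rewrite !mulrBr lerB// B.
Qed.

(** For arguments of the same sign this is the tangent inequality for
    [t^(r+1)]; for opposite signs the distance is [|x| + |y|] and each power
    is bounded separately. *)
Lemma spow_lip x y r m : 0 <= r -> `|x| <= m -> `|y| <= m ->
  `|spow r x - spow r y| <= (r + 1) * m `^ r * `|x - y|.
Proof.
move=> r0; wlog xy : x y / y <= x.
  move=> H; case: (leP y x) => [|/ltW] xy xm ym; first exact: H.
  by rewrite distrC (distrC x); exact: H.
move=> xm ym.
have m0 : 0 <= m by apply: le_trans xm.
have X z : `|z| <= m -> `|z| `^ r <= m `^ r by move=> zm; exact: ler_powRl.
have T u v : 0 <= v -> v <= u -> u <= m ->
    `|u * u `^ r - v * v `^ r| <= (r + 1) * m `^ r * (u - v).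
  move=> v0 vu um.
  have u0 : 0 <= u by exact: le_trans vu.
  have E w : 0 <= w -> w * w `^ r = w `^ (r + 1).
    move=> w0; have := @mulr_powRB1 _ w (r + 1) w0; rewrite addrK; apply; lra.
  rewrite ger0_norm; last first.
    rewrite subr_ge0 ler_pM ?powR_ge0//; exact: ler_powRl.
  rewrite !E//.
  have := @powR_tangent v u (r + 1) _ v0 u0; rewrite addrK => /(_ ltac:(lra)) H.
  have : (r + 1) * u `^ r * (u - v) <= (r + 1) * m `^ r * (u - v).
    rewrite ler_wpM2r ?subr_ge0// ler_wpM2l//; first lra.
    exact: ler_powRl.
  lra.
rewrite /spow [`|x - y|]ger0_norm ?subr_ge0//.
case: (leP 0 y) => y0.
  have x0 : 0 <= x by lra.
  by rewrite (ger0_norm x0) (ger0_norm y0) in xm *; exact: T.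
case: (leP x 0) => x0.
  have y0' := ltW y0.
  rewrite (ler0_norm x0) (ler0_norm y0') in xm ym *.
  have := T (- y) (- x) _ _ ym.
  rewrite oppr_ge0 lerN2 => /(_ x0 xy).
  have -> : - y * (- y) `^ r - - x * (- x) `^ r =
    x * (- x) `^ r - y * (- y) `^ r by ring.
  by have -> : - y - - x = x - y by ring.
have -> : x * `|x| `^ r - y * `|y| `^ r = x * `|x| `^ r + (- y) * `|y| `^ r.
  by ring.
have A : x * `|x| `^ r <= x * m `^ r by rewrite ler_pM2l// X.
have B : - y * `|y| `^ r <= - y * m `^ r by rewrite ler_pM2l ?X//; lra.
have C : 0 <= r * m `^ r * (x - y) by rewrite !mulr_ge0 ?powR_ge0//; lra.
rewrite ger0_norm; last by rewrite addr_ge0// mulr_ge0 ?powR_ge0//; lra.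
lra.
Qed.

(** Bound [a + b] below by [a] and by [b] in the two terms of
    [(a + b)^q = a (a + b)^(q-1) + b (a + b)^(q-1)]. *)
Lemma powR_superadd a b q : 1 <= q -> 0 <= a -> 0 <= b ->
  a `^ q + b `^ q <= (a + b) `^ q.
Proof.
move=> q1 a0 b0.
have q0 : 0 < q by lra.
rewrite -(@mulr_powRB1 _ a q)// -(@mulr_powRB1 _ b q)//.
rewrite -(@mulr_powRB1 _ (a + b) q) ?addr_ge0// mulrDl.
by rewrite lerD// ler_wpM2l// ler_powRl//; lra.
Qed.

Lemma powR_addl u v r : 0 <= r -> 0 <= u -> 0 <= v ->
  (u + v) `^ r <= 2 `^ r * (u `^ r + v `^ r).
Proof.
move=> r0; wlog uv : u v / u <= v.
  move=> H; case: (leP u v) => [|/ltW] uv u0 v0; first exact: H.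
  by rewrite addrC [X in _ * X]addrC; exact: H.
move=> u0 v0; apply: (@le_trans _ _ ((2 * v) `^ r)).
  by rewrite ler_powRl//; lra.
by rewrite powRM// ler_wpM2l ?powR_ge0// lerDr powR_ge0.
Qed.

(** Compare [v^2] with [t u^2]: in either case one term on the right suffices.
    The free parameter [t] replaces Hoelder's inequality: choosing it after
    integration recovers, up to a factor, the bound by a product of norms. *)
Lemma powR_young u v q t : 1 <= q -> 0 <= u -> 0 <= v -> 0 < t ->
  u `^ (2 * q - 2) * v ^+ 2 <= t * u `^ (2 * q) + t `^ (1 - q) * v `^ (2 * q).
Proof.
move=> q1 u0 v0 t0.
have q20 : 0 < 2 * q by lra.
have P2 w : 0 <= w -> w `^ (2 * q) = w ^+ 2 * w `^ (2 * q - 2).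
  move=> w0; rewrite -(mulr_powRB1 w0)// expr2 -mulrA; congr (_ * _).
  case: (eqVneq q 1) => [->|qn1].
    have -> : 2 * 1 - 1 = 1 :> R by ring.
    by have -> : 2 * 1 - 2 = 0 :> R; [ring | rewrite powRr0 mulr1 powRr1].
  rewrite -(mulr_powRB1 w0).
    by have -> : 2 * q - 1 - 1 = 2 * q - 2 by ring.
  lra.
case: (leP (v ^+ 2) (t * u ^+ 2)) => H.
  apply: (@le_trans _ _ (t * u `^ (2 * q))).
    by rewrite P2// mulrA mulrC ler_wpM2r ?powR_ge0.
  by rewrite lerDl mulr_ge0 ?powR_ge0.
apply: (@le_trans _ _ (t `^ (1 - q) * v `^ (2 * q))); last first.
  by rewrite lerDr mulr_ge0 ?powR_ge0// ltW.
rewrite (P2 v v0) mulrC mulrCA ler_wpM2l ?exprn_ge0//.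
have S w : 0 <= w -> w `^ (2 * q - 2) = (w ^+ 2) `^ (q - 1).
  move=> w0; rewrite -powR_mulrn// -powRrM.
  by have -> : 2 * q - 2 = 2%:R * (q - 1) by ring.
rewrite !S//.
have -> : t `^ (1 - q) = (t `^ (q - 1))^-1.
  by rewrite -powRN; congr (_ `^ _); ring.
have t0' := ltW t0.
rewrite ler_pdivlMl ?powR_gt0// -powRM ?exprn_ge0// ler_powRl//.
- by rewrite subr_ge0.
- by rewrite mulr_ge0 ?exprn_ge0.
- exact: ltW.
Qed.

Lemma spow_young x y p : 2 <= p ->
  `|spow (p - 2) x * y| <= `|x| `^ p + `|y| `^ p.
Proof.
move=> p2; rewrite normrM norm_spow; last lra.
have -> : p - 2 + 1 = p - 1 by ring.
case: (leP `|x| `|y|) => xy.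
  apply: (@le_trans _ _ (`|y| `^ (p - 1) * `|y|)).
    by rewrite ler_wpM2r// ler_powRl//; lra.
  by rewrite mulrC mulr_powRB1 ?lerDr ?powR_ge0//; lra.
apply: (@le_trans _ _ (`|x| `^ (p - 1) * `|x|)).
  by rewrite ler_wpM2l ?powR_ge0// ltW.
by rewrite mulrC mulr_powRB1 ?lerDl ?powR_ge0//; lra.
Qed.

(** The tangent inequality at [x + y], evaluated at [x], bounds [|x + y|^p] by
    [|x|^p] plus [p] times the signed power at [x + y] times [y]. Replacing
    that signed power by the one at [x] costs a term of second order in [y],
    by the Lipschitz estimate. *)
Lemma powR_norm_smooth x y p : 2 <= p ->
  `|x + y| `^ p <= `|x| `^ p + p * (spow (p - 2) x * y) +
    p * (p - 1) * 2 `^ (p - 2) * (`|x| `^ (p - 2) * `|y| ^+ 2 + `|y| `^ p).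
Proof.
move=> p2.
have := @powR_norm_tangent x (x + y) p p2.
have -> : x - (x + y) = - y by ring.
move=> H.
have L : `|spow (p - 2) (x + y) - spow (p - 2) x| <=
    (p - 1) * (`|x| + `|y|) `^ (p - 2) * `|y|.
  have := @spow_lip (x + y) x (p - 2) (`|x| + `|y|).
  have -> : x + y - x = y by ring.
  have -> : p - 2 + 1 = p - 1 by ring.
  apply; [lra|exact: ler_normD|by rewrite lerDl].
have L2 : (spow (p - 2) (x + y) - spow (p - 2) x) * y <=
    (p - 1) * 2 `^ (p - 2) * (`|x| `^ (p - 2) * `|y| ^+ 2 + `|y| `^ p).
  apply: (le_trans (ler_norm _)); rewrite normrM.
  apply: (@le_trans _ _ ((p - 1) * (`|x| + `|y|) `^ (p - 2) * `|y| * `|y|)).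
    by rewrite ler_wpM2r.
  have -> : `|y| `^ p = `|y| `^ (p - 2) * `|y| ^+ 2.
    rewrite -(mulr_powRB1 (normr_ge0 y)); last lra.
    case: (eqVneq p 2) => [->|pn].
      have -> : 2 - 1 = 1 :> R by ring.
      by rewrite subrr powRr0 mul1r powRr1.
    rewrite -(mulr_powRB1 (normr_ge0 y)); last lra.
    have -> : p - 1 - 1 = p - 2 by ring.
    ring.
  rewrite -mulrDl -!mulrA ler_wpM2l//; first lra.
  rewrite -expr2 !mulrA ler_wpM2r ?exprn_ge0//.
  by rewrite ler_wpM2r//; apply: powR_addl => //; lra.
have {}L2 : p * ((spow (p - 2) (x + y) - spow (p - 2) x) * y) <= p *
    ((p - 1) * 2 `^ (p - 2) * (`|x| `^ (p - 2) * `|y| ^+ 2 + `|y| `^ p)).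
  by rewrite ler_wpM2l//; lra.
lra.
Qed.

End pointwise.

(** Four times the constant of [powR_norm_smooth]; the factor 4 leaves room to
    absorb both error terms of that expansion into [(a + K b)^(p/2)]. *)
Definition smooth_const {R : realType} (p : R) : R :=
  4 * (p * (p - 1) * 2 `^ (p - 2)).

Lemma smooth_const_ge4 {R : realType} (p : R) : 2 <= p -> 4 <= smooth_const p.
Proof.
move=> p2; rewrite /smooth_const.
have H : 1 <= 2 `^ (p - 2) :> R.
  by rewrite -[X in X <= _](powRr0 2) ler_powR//; lra.
have : 1 * 1 <= p * (p - 1) * 2 `^ (p - 2) by rewrite ler_pM//; nra.
lra.
Qed.

Lemma smooth_const_ge1 {R : realType} (p : R) : 2 <= p -> 1 <= smooth_const p.
Proof. by move=> /smooth_const_ge4; lra. Qed.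

Section numeric.
Context {R : realType}.
Implicit Types (a b K q : R).

(** The left-hand side is
    [a^q + 2 K a^(q-1) b + K b^q]. The power [(a + 4 K b)^q] dominates both
    its tangent at [a] and, by superadditivity, [a^q + (4 K b)^q]; the average
    of the two lower bounds is large enough. *)
Lemma smooth_numeric a b K q : 1 <= q -> 1 <= K -> 0 < a -> 0 < b ->
  (1 + K * (b / a)) * a `^ q + K * ((b / a) `^ (1 - q) + 1) * b `^ q <=
  (a + 4 * K * b) `^ q.
Proof.
move=> q1 K1 a0 b0.
have a0' := ltW a0; have b0' := ltW b0.
set c := 4 * K * b.
have c0 : 0 <= c by rewrite !mulr_ge0//; lra.
have q0 : 0 < q by lra.
have H1 := @powR_superadd R a c q q1 a0' c0.
have H2 := @powR_tangent R (a + c) a q q1 (addr_ge0 a0' c0) a0'.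
rewrite [a + c - a]addrC addKr in H2.
have H3 : 4 * K * b `^ q <= c `^ q.
  rewrite /c powRM//; last by rewrite mulr_ge0//; lra.
  rewrite ler_wpM2r ?powR_ge0// le1r_powR//; lra.
have aq : a `^ q = a * a `^ (q - 1) by rewrite mulr_powRB1.
have bq : b `^ q = b * b `^ (q - 1) by rewrite mulr_powRB1.
have E1 : b / a * a `^ q = b * a `^ (q - 1).
  by rewrite aq; field; rewrite gt_eqF.
have E2 : (b / a) `^ (1 - q) * b `^ q = b * a `^ (q - 1).
  have E3 : b `^ (q - 1) = (b / a) `^ (q - 1) * a `^ (q - 1).
    by rewrite -powRM ?divr_ge0// divfK// gt_eqF.
  have -> : 1 - q = - (q - 1) by ring.
  rewrite powRN bq E3; field.
  by rewrite gt_eqF// powR_gt0// divr_gt0.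
have H4 : 4 * K * (b * a `^ (q - 1)) <= q * a `^ (q - 1) * c.
  have -> : q * a `^ (q - 1) * c = q * (4 * K * (b * a `^ (q - 1))).
    by rewrite /c; ring.
  rewrite ler_peMl// !mulr_ge0 ?powR_ge0//; lra.
have H5 : K * (b * a `^ (q - 1)) >= 0 by rewrite !mulr_ge0 ?powR_ge0//; lra.
have H6 : K * b `^ q >= 0 by rewrite !mulr_ge0 ?powR_ge0//; lra.
have -> : (1 + K * (b / a)) * a `^ q + K * ((b / a) `^ (1 - q) + 1) * b `^ q =
  a `^ q + K * (b / a * a `^ q) + K * ((b / a) `^ (1 - q) * b `^ q)
    + K * b `^ q by ring.
rewrite E1 E2; lra.
Qed.

End numeric.

(** * Two-point inequality for absolute moments *)

Section moments.
Context d (T : measurableType d) (R : realType) (P : probability T R).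
Implicit Types (f g X Y : T -> R) (p q a b c : R).

Definition amom p f : \bar R := (\int[P]_w (`|f w| `^ p)%:E)%E.

Lemma measurable_powR_comp f q : measurable_fun setT f ->
  measurable_fun setT (fun w => f w `^ q).
Proof. by move=> mf; exact: (measurableT_comp (measurable_powR q)). Qed.

Lemma measurable_normpow p f : measurable_fun setT f ->
  measurable_fun setT (fun w => `|f w| `^ p).
Proof. by move=> mf; apply: measurable_powR_comp; exact: measurableT_comp. Qed.

Lemma measurable_spow r f : measurable_fun setT f ->
  measurable_fun setT (fun w => spow r (f w)).
Proof. by move=> mf; apply: measurable_funM => //; exact: measurable_normpow. Qed.

Lemma amom_ge0 p f : (0 <= amom p f)%E.
Proof. by apply: integral_ge0 => w _; rewrite lee_fin powR_ge0. Qed.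

Lemma amom_integrable p f : measurable_fun setT f -> (amom p f < +oo)%E ->
  P.-integrable setT (fun w => (`|f w| `^ p)%:E).
Proof.
move=> mf fp; apply/integrableP; split.
  by apply/measurable_EFinP; exact: measurable_normpow.
by under eq_integral do rewrite gee0_abs ?lee_fin ?powR_ge0//.
Qed.

Lemma integrable_le f g : measurable_fun setT f ->
  P.-integrable setT (EFin \o g) -> (forall w, `|f w| <= g w) ->
  P.-integrable setT (EFin \o f).
Proof.
move=> mf ig fg; apply: le_integrable ig => //; first exact/measurable_EFinP.
by move=> w _ /=; rewrite lee_fin (le_trans (fg w))// ler_norm.
Qed.

Lemma amom_add0 p X Y : 0 < p -> measurable_fun setT X -> measurable_fun setT Y ->
  (amom p Y <= 0)%E -> amom p (fun w => (X w + Y w)%R) = amom p X.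
Proof.
move=> p0 mX mY Y0.
have mYp : measurable_fun setT (fun w => (`|Y w| `^ p)%:E).
  by apply/measurable_EFinP; exact: measurable_normpow.
have : ae_eq P setT (fun w => (`|Y w| `^ p)%:E) (cst 0%E).
  apply/ae_eq_integral_abs => //.
  under eq_integral do rewrite gee0_abs ?lee_fin ?powR_ge0//.
  by apply/eqP; rewrite eq_le Y0 amom_ge0.
move=> YE; apply: ge0_ae_eq_integral => //.
- apply/measurable_EFinP; apply: measurable_normpow; exact: measurable_funD.
- by apply/measurable_EFinP; exact: measurable_normpow.
- apply: filterS YE => w /= /(_ I) [/powR_eq0_eq0/normr0_eq0 ->] _.
  by rewrite addr0.
Qed.

(** Integrate the pointwise expansion: the first-order term vanishes by
    hypothesis. With [t = b / a] in [powR_young] the error is of order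
    [a^(q-1) b + b^q]. A zero bound forces the function to vanish almost
    everywhere, and this case is treated apart because [t] is then
    meaningless. *)
Lemma smooth_step p q X Y a b : p = 2 * q -> 1 <= q ->
  measurable_fun setT X -> measurable_fun setT Y -> 0 <= a -> 0 <= b ->
  (amom p X <= (a `^ q)%:E)%E -> (amom p Y <= (b `^ q)%:E)%E ->
  (\int[P]_w (spow (p - 2) (X w) * Y w)%:E = 0)%E ->
  (amom p (fun w => (X w + Y w)%R) <= ((a + smooth_const p * b) `^ q)%:E)%E.
Proof.
move=> pq q1 mX mY a0 b0 Xa Yb XY0.
have p2 : 2 <= p by lra.
have p0 : 0 < p by lra.
have q0 : q != 0 by lra.
pose L := p * (p - 1) * 2 `^ (p - 2) : R.
have KE : smooth_const p = 4 * L by [].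
have L1 : 1 <= L by have := smooth_const_ge4 p2; rewrite KE; lra.
have K1 := smooth_const_ge1 p2.
move: b0; rewrite le_eqVlt => /predU1P[b0|b0].
  rewrite -b0 powR0// in Yb.
  by rewrite amom_add0// -b0 mulr0 addr0.
move: a0; rewrite le_eqVlt => /predU1P[a0|a0].
  rewrite -a0 powR0// in Xa; rewrite -a0 add0r.
  have -> : (fun w => X w + Y w) = (fun w => Y w + X w).
    by apply/funext => w /=; rewrite addrC.
  rewrite amom_add0//; apply: (le_trans Yb); rewrite lee_fin.
  by rewrite ler_powRl//; [lra|exact: ltW|rewrite ler_peMl// ltW].
have iX : P.-integrable setT (fun w => (`|X w| `^ p)%:E).
  by apply: amom_integrable => //; apply: le_lt_trans Xa _; rewrite ltry.
have iY : P.-integrable setT (fun w => (`|Y w| `^ p)%:E).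
  by apply: amom_integrable => //; apply: le_lt_trans Yb _; rewrite ltry.
have mS : measurable_fun setT (fun w => spow (p - 2) (X w) * Y w).
  by apply: measurable_funM => //; exact: measurable_spow.
have iS : P.-integrable setT (EFin \o (fun w => spow (p - 2) (X w) * Y w)).
  apply: (@integrable_le _ (fun w => `|X w| `^ p + `|Y w| `^ p)) => //.
    rewrite (_ : _ \o _ = (EFin \o (fun w => `|X w| `^ p)) \+
      (EFin \o (fun w => `|Y w| `^ p)))//.
    exact: integrableD.
  by move=> w; exact: spow_young.
pose c1 := 1 + L * (b / a).
pose c2 := L * ((b / a) `^ (1 - q) + 1).
have ba : 0 < b / a by exact: divr_gt0.
have c10 : 0 <= c1 by rewrite addr_ge0// mulr_ge0//; lra.
have c20 : 0 <= c2 by rewrite mulr_ge0 ?addr_ge0 ?powR_ge0//; lra.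
have mXp := measurable_normpow p mX.
have mYp := measurable_normpow p mY.
(* [powR_norm_smooth] followed by [powR_young] with [t = b / a] *)
apply: (@le_trans _ _ (\int[P]_w ((c1%:E * (`|X w| `^ p)%:E +
   c2%:E * (`|Y w| `^ p)%:E) + p%:E * (spow (p - 2) (X w) * Y w)%:E))%E).
  have H w : `|X w + Y w| `^ p <= c1 * `|X w| `^ p + c2 * `|Y w| `^ p +
      p * (spow (p - 2) (X w) * Y w).
    apply: (le_trans (powR_norm_smooth (X w) (Y w) p2)).
    have := @powR_young R `|X w| `|Y w| q (b / a) q1 (normr_ge0 _) (normr_ge0 _) ba.
    rewrite -pq -/L => /(ler_wpM2l (_ : 0 <= L)) H.
    have {}H := H ltac:(lra).
    rewrite /c1 /c2; lra.
  apply: ge0_le_integral => //.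
  - apply/measurable_EFinP; apply: measurable_normpow; exact: measurable_funD.
  - apply/(measurable_EFinP setT (fun w => c1 * `|X w| `^ p + c2 * `|Y w| `^ p +
      p * (spow (p - 2) (X w) * Y w))).
    apply: measurable_funD; first apply: measurable_funD;
    by apply: measurable_funM.
  - by move=> w _; rewrite -!EFinM -!EFinD lee_fin.
rewrite integralD//; last 2 first.
  - by apply: integrableD => //; exact: integrableZl.
  - exact: integrableZl.
rewrite integralD//; last 2 first.
  - exact: integrableZl.
  - exact: integrableZl.
rewrite !integralZl// XY0 mule0 adde0.
apply: (@le_trans _ _ (c1%:E * (a `^ q)%:E + c2%:E * (b `^ q)%:E)%E).
  by rewrite leeD// lee_wpmul2l// lee_fin.
by rewrite -!EFinM -EFinD lee_fin KE; exact: smooth_numeric.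
Qed.

End moments.

(** * Functions of the past and independence *)

Section past.
Context d (T : measurableType d) (R : realType) (P : probability T R).
Context dE (E : measurableType dE) (I : finType) (Z : I -> T -> E).
Hypothesis mZ : forall i, measurable_fun setT (Z i).
Implicit Types (J : {set I}) (f g X : T -> R) (B : I -> set E).

Definition box J B : set T := \bigcap_(i in [set` J]) (Z i @^-1` B i).

Definition boxes J : set (set T) :=
  [set A | exists2 B, (forall i, measurable (B i)) & A = box J B].

(** Measurability with respect to the sigma-algebra generated by the [Z i],
    [i] in [J]. Boxes are preferred to single preimages as generators because
    they form a pi-system. *)
Definition past J f :=
  measurable_fun (setT : set (g_sigma_algebraType (boxes J))) f.

Lemma boxes_setI J : setI_closed (boxes J).
Proof.
move=> _ _ [B mB ->] [C mC ->]; exists (fun i => B i `&` C i).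
  by move=> i; exact: measurableI.
rewrite /box -bigcapI; apply: eq_bigcapr => i _; exact: preimage_setI.
Qed.

Lemma box_measurable J B : (forall i, measurable (B i)) -> measurable (box J B).
Proof.
move=> mB; apply: fin_bigcap_measurable => // i _.
by rewrite -[X in measurable X]setTI; exact: mZ.
Qed.

Lemma sigma_boxes_measurable J : <<s boxes J >> `<=` measurable.
Proof.
apply: smallest_sub; first exact: sigma_algebra_measurable.
by move=> _ [B mB ->]; exact: box_measurable.
Qed.

Lemma past_measurable J f : past J f -> measurable_fun setT f.
Proof.
by move=> pf _ Y mY; apply: (@sigma_boxes_measurable J); exact: pf.
Qed.

Lemma boxes_sub J J' : J \subset J' -> boxes J `<=` boxes J'.
Proof.
move=> JJ' _ [B mB ->].
exists (fun i => if i \in J then B i else setT).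
  by move=> i; case: ifP.
apply/seteqP; split => w /= H i /=.
  move=> iJ'; case: ifPn => // iJ; exact: H.
by move=> iJ; have := H i (fintype.subsetP JJ' _ iJ); rewrite iJ.
Qed.

Lemma past_sub J J' f : J \subset J' -> past J f -> past J' f.
Proof.
move=> JJ' pf _ Y mY.
have H : <<s boxes J >> (setT `&` f @^-1` Y) by exact: pf.
exact: sub_sigma_algebra2 (boxes_sub JJ') _ H.
Qed.

Lemma past_coord J i (g : E -> R) : i \in J -> measurable_fun setT g ->
  past J (fun w => g (Z i w)).
Proof.
move=> iJ mg _ Y mY; rewrite setTI; apply: sub_sigma_algebra.
exists (fun j => if j == i then g @^-1` Y else setT).
  by move=> j; case: ifP => // _; rewrite -[X in measurable X]setTI; exact: mg.
apply/seteqP; split => w /= H.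
  by move=> j _ /=; case: ifPn => // /eqP ->.
by have := H i iJ => /=; rewrite eqxx.
Qed.

Hypothesis indep : forall J B, (forall i, measurable (B i)) ->
  P (box J B) = (\prod_(i in J) P (Z i @^-1` B i))%E.

Lemma boxU1 k J B : k \notin J -> box (k |: J) B = box J B `&` Z k @^-1` B k.
Proof.
move=> kJ; apply/seteqP; split=> w /=.
  by move=> H; split; [move=> i /= iJ|]; apply: H => /=; rewrite !inE ?iJ ?orbT ?eqxx.
by move=> [H1 H2] i /=; rewrite !inE => /orP[/eqP ->//|]; exact: H1.
Qed.

Lemma box_indep k J A C : k \notin J -> boxes J A -> measurable C ->
  P (A `&` Z k @^-1` C) = (P A * P (Z k @^-1` C))%E.
Proof.
move=> kJ [B mB ->] mC.
(* changing [B] at [k] does not change the box over [J] *)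
pose B' i := if i == k then C else B i.
have mB' i : measurable (B' i) by rewrite /B'; case: ifP.
have EB : box J B = box J B'.
  apply: eq_bigcapr => i /= iJ; rewrite /B'; case: eqP => // ik.
  by rewrite -ik iJ in kJ.
have EC : C = B' k by rewrite /B' eqxx.
rewrite EB [in LHS]EC -boxU1// !indep// big_setU1//= muleC.
by rewrite -EC.
Qed.

(** Pi-lambda theorem: the events that satisfy the product formula with a
    fixed event of [Z k] form a Dynkin system. *)
Lemma past_indep k J A C : k \notin J -> <<s boxes J >> A -> measurable C ->
  P (A `&` Z k @^-1` C) = (P A * P (Z k @^-1` C))%E.
Proof.
move=> kJ sA mC; set D := Z k @^-1` C.
have mD : measurable D by rewrite -[D]setTI; exact: mZ.
pose H := [set A : set T | measurable A /\ P (A `&` D) = (P A * P D)%E].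
suff : <<s boxes J >> `<=` H by move=> /(_ _ sA)[].
rewrite -setI_closed_g_dynkin_g_sigma_algebra; last exact: boxes_setI.
apply: smallest_sub; last first.
  move=> B bB; split; last exact: (box_indep kJ bB mC).
  by case: bB => C' mC' ->; exact: box_measurable.
split.
- by split => //; rewrite setTI probability_setT mul1e.
- move=> B [mB HB]; split; first exact: measurableC.
  rewrite probability_setC// muleBl ?fin_num_measure//.
  rewrite mul1e -HB [in RHS]setIC [in LHS]setIC -setDE measureD//.
  by rewrite ltey_eq fin_num_measure.
- move=> F tF HF.
  have mF n : measurable (F n) by have [] := HF n.
  split; first exact: bigcupT_measurable.
  rewrite setI_bigcupl measure_bigcup//; last 2 first.
    by move=> n _; exact: measurableI.
    exact: trivIset_setIr.
  rewrite measure_bigcup// -(fineK (fin_num_measure P D mD)) muleC.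
  rewrite -nneseriesZl//; apply: eq_eseriesr => n _.
  transitivity (P (F n) * P D)%E; first by have [] := HF n.
  by rewrite muleC fineK// fin_num_measure.
Qed.

End past.

Section indep2.
Context d (T : measurableType d) (R : realType) (P : probability T R).
Implicit Types X Y : T -> R.

Definition indep2 X Y := forall A B : set R, measurable A -> measurable B ->
  P (X @^-1` A `&` Y @^-1` B) = (P (X @^-1` A) * P (Y @^-1` B))%E.

Lemma past_indep2 dE (E : measurableType dE) (I : finType) (Z : I -> T -> E)
    (J : {set I}) k X (g : E -> R) :
  (forall i, measurable_fun setT (Z i)) ->
  (forall J B, (forall i, measurable (B i)) ->
    P (box Z J B) = (\prod_(i in J) P (Z i @^-1` B i))%E) ->
  k \notin J -> past Z J X -> measurable_fun setT g ->
  indep2 X (fun w => g (Z k w)).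
Proof.
move=> mZ iZ kJ pX mg A B mA mB.
rewrite -[X @^-1` A]setTI (_ : _ @^-1` B = Z k @^-1` (g @^-1` B))//.
apply: past_indep kJ _ _ => //; first exact: pX.
by rewrite -[X in measurable X]setTI; exact: mg.
Qed.

(** Under independence the joint law is the product of the two laws, so both
    formulas below are instances of Fubini's theorem. *)
Section product.
Variables X Y : {RV P >-> R}.
Hypothesis XY : indep2 X Y.

Let mZ : measurable_fun setT (fun w => (X w, Y w)).
Proof. exact: measurable_fun_pair. Qed.

Let joint : {RV P >-> (R * R)%type} :=
  HB.pack (fun w => (X w, Y w)) (isMeasurableFun.Build _ _ _ _ _ mZ).

Let jointE A : measurable A ->
  (distribution P X \x distribution P Y)%E A = distribution P joint A.
Proof. by apply: product_measure_unique => B C mB mC; exact: XY. Qed.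

Local Open Scope ereal_scope.

Lemma indep2_integral_norm :
  \int[P]_w (`|X w| * `|Y w|)%:E =
  (\int[P]_w `|X w|%:E) * (\int[P]_w `|Y w|%:E).
Proof.
have mf : measurable_fun setT (fun z : R * R => (`|z.1| * `|z.2|)%:E : \bar R).
  apply/measurable_EFinP/measurable_funM; exact: measurableT_comp.
have mn : measurable_fun setT (fun x : R => `|x|%:E : \bar R).
  by apply/measurable_EFinP.
rewrite -[LHS](ge0_integral_distribution joint mf) => [|z]; last first.
  by rewrite lee_fin mulr_ge0.
rewrite -[X in X * _](ge0_integral_distribution X mn) => [|z]; last first.
  by rewrite lee_fin.
rewrite -[X in _ * X](ge0_integral_distribution Y mn) => [|z]; last first.
  by rewrite lee_fin.
transitivity (\int[distribution P X \x distribution P Y]_z (`|z.1| * `|z.2|)%:E).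
  apply: eq_measure_integral => A mA _; exact: (esym (jointE mA)).
rewrite fubini_tonelli1//.
rewrite /fubini_F muleC -ge0_integralZl//; last exact: integral_ge0.
apply: eq_integral => x _.
under eq_integral do rewrite /= EFinM.
by rewrite ge0_integralZl// muleC.
Qed.

Lemma indep2_integral_centered :
  P.-integrable setT (EFin \o X) -> P.-integrable setT (EFin \o Y) ->
  \int[P]_w (Y w)%:E = 0 ->
  P.-integrable setT (fun w => (X w * Y w)%:E) /\
  \int[P]_w (X w * Y w)%:E = 0.
Proof.
move=> iX iY Y0.
have iXY : P.-integrable setT (fun w => (X w * Y w)%:E).
  apply/integrableP; split.
    by apply/measurable_EFinP; exact: measurable_funM.
  under eq_integral do rewrite /= normrM.
  rewrite indep2_integral_norm.
  move/integrableP : iX => [_ iX]; move/integrableP : iY => [_ iY].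
  have X0 : 0 <= \int[P]_w `|X w|%:E by exact: integral_ge0.
  by rewrite lte_mul_pinfty// ge0_fin_numE.
split => //.
pose f (z : R * R) : \bar R := (z.1 * z.2)%:E.
have mf : measurable_fun setT f.
  by apply/measurable_EFinP/measurable_funM.
have mid : measurable_fun setT (EFin : R -> \bar R) by exact/measurable_EFinP.
rewrite -[LHS](integral_distribution (X := joint) mf)//.
have E : forall A, measurable A -> A `<=` setT ->
   distribution P joint A = (distribution P X \x distribution P Y) A.
  by move=> A mA _; exact: (esym (jointE mA)).
rewrite (eq_measure_integral _ E) -integral12_prod_meas1.
  rewrite /fubini_F /f /=; under eq_integral => x _.
    under eq_integral do rewrite EFinM.
    rewrite integralZl//; last exact: integrable_pushforward.
    rewrite (integral_distribution (X := Y) mid)// [X in _ * X]Y0 mule0.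
    over.
  by rewrite integral0.
apply/integrableP; split => //.
rewrite -(eq_measure_integral _ E).
rewrite (ge0_integral_distribution joint)//; last exact: measurableT_comp.
by move/integrableP : iXY => [].
Qed.

End product.

End indep2.

(** * Martingale moment inequality *)

Definition upto n (m : nat) : {set 'I_n} := [set j : 'I_n | (j < m)%N]%SET.

Lemma uptoS n (k : 'I_n) : upto n k.+1 = k |: upto n k.
Proof. by apply/setP => j; rewrite !inE ltnS leq_eqVlt val_eqE. Qed.

Lemma upto_notin n (k : 'I_n) : k \notin upto n k.
Proof. by rewrite inE ltnn. Qed.

Section triangular.
Context {R : realType} (n : nat).

(** Entries are grouped by the larger of their two indices. *)
Lemma sum_triangular (F : 'I_n -> 'I_n -> R) :
  \sum_i \sum_j F i j =
  \sum_(k < n) (F k k + \sum_(j in upto n k) (F k j + F j k)).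
Proof.
have -> : \sum_(k < n) (F k k + \sum_(j in upto n k) (F k j + F j k)) =
  \sum_(k < n) (F k k + \sum_(j < n | (j < k)%N) F k j) +
  \sum_(k < n) \sum_(j < n | (j < k)%N) F j k.
  rewrite -big_split; apply: eq_bigr => k _ /=; rewrite -addrA -big_split /=.
  by congr (_ + _); apply: eq_bigl => j; rewrite inE.
rewrite [X in _ + X](exchange_big_dep predT)//= -big_split.
apply: eq_bigr => i _ /=; rewrite (bigD1 i)//= -addrA; congr (_ + _).
rewrite (bigID (fun j : 'I_n => (j < i)%N)) /=; congr (_ + _).
  by apply: eq_bigl => j; rewrite -val_eqE /=; case: ltngtP.
by apply: eq_bigl => j; rewrite -val_eqE /=; case: ltngtP.
Qed.

End triangular.

Section martingale.
Context d (T : measurableType d) (R : realType) (P : probability T R).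
Context dE (E : measurableType dE) (n : nat) (Z : 'I_n -> T -> E).
Hypothesis mZ : forall i, measurable_fun setT (Z i).
Hypothesis indep : forall (J : {set 'I_n}) B, (forall i, measurable (B i)) ->
  P (box Z J B) = (\prod_(i in J) P (Z i @^-1` B i))%E.
Implicit Types (X U : T -> R) (p q : R) (g : E -> R) (J : {set 'I_n}).

Lemma past_sum (I : finType) J (A : {set I}) (F : I -> T -> R) :
  (forall i, i \in A -> past Z J (F i)) ->
  past Z J (fun w => \sum_(i in A) F i w).
Proof.
move=> pF; rewrite /past.
rewrite (_ : (fun w => _) = (fun w => \sum_(i <- enum A) F i w)); last first.
  by apply/funext => w; rewrite big_enum.
have : forall i, i \in enum A -> past Z J (F i) by move=> i; rewrite mem_enum; exact: pF.
elim: (enum A) => [|i s ih] H.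
  by rewrite (_ : (fun w => _) = cst 0)//; apply/funext => w; rewrite big_nil.
rewrite (_ : (fun w => _) = (fun w => F i w + \sum_(j <- s) F j w)); last first.
  by apply/funext => w; rewrite big_cons.
apply: measurable_funD; first by apply: H; rewrite inE eqxx.
by apply: ih => j js; apply: H; rewrite inE js orbT.
Qed.

(** Independence factors the moment of a product; this is where the moments
    of the new coordinate separate from those of the past. *)
Lemma amom_product p k J U g : k \notin J -> past Z J U ->
  measurable_fun setT g ->
  amom P p (fun w => g (Z k w) * U w) =
  (amom P p (fun w => g (Z k w)) * amom P p U)%E.
Proof.
move=> kJ pU mg.
have mgp := measurable_normpow p mg.
have pUp : past Z J (fun w => `|U w| `^ p) by exact: measurable_normpow.
have := past_indep2 mZ indep kJ pUp mgp.
have mX := past_measurable mZ pUp.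
have mY : measurable_fun setT (fun w => `|g (Z k w)| `^ p).
  exact: (measurableT_comp mgp (mZ k)).
pose X : {RV P >-> R} := HB.pack (fun w => `|U w| `^ p)
  (isMeasurableFun.Build _ _ _ _ _ mX).
pose Y : {RV P >-> R} := HB.pack (fun w => `|g (Z k w)| `^ p)
  (isMeasurableFun.Build _ _ _ _ _ mY).
move=> /(@indep2_integral_norm _ _ _ _ X Y) H.
have EX : amom P p U = (\int[P]_w `|X w|%:E)%E.
  by apply: eq_integral => w _ /=; rewrite [X in _ = X%:E]ger0_norm ?powR_ge0.
have EY : amom P p (fun w => g (Z k w)) = (\int[P]_w `|Y w|%:E)%E.
  by apply: eq_integral => w _ /=; rewrite [X in _ = X%:E]ger0_norm ?powR_ge0.
rewrite EX EY muleC -H; apply: eq_integral => w _ /=.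
by rewrite !(ger0_norm (powR_ge0 _ _)) normrM powRM// mulrC.
Qed.

(** This supplies the orthogonality hypothesis of [smooth_step]. The signed
    power of [X] times [U] is a function of the past, integrable by Young's
    inequality. *)
Lemma centered_orth p k J X U g : 2 <= p -> k \notin J -> past Z J X -> past Z J U ->
  measurable_fun setT g ->
  P.-integrable setT (fun w => (g (Z k w))%:E) ->
  (\int[P]_w (g (Z k w))%:E = 0)%E ->
  (amom P p X < +oo)%E -> (amom P p U < +oo)%E ->
  P.-integrable setT (fun w => (spow (p - 2) (X w) * (g (Z k w) * U w))%:E) /\
  (\int[P]_w (spow (p - 2) (X w) * (g (Z k w) * U w))%:E = 0)%E.
Proof.
move=> p2 kJ pX pU mg ig g0 Xoo Uoo.
have pXU : past Z J (fun w => spow (p - 2) (X w) * U w).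
  by apply: measurable_funM => //; exact: measurable_spow.
have mX := past_measurable mZ pX.
have mU := past_measurable mZ pU.
have mXU := past_measurable mZ pXU.
have mY : measurable_fun setT (fun w => g (Z k w)).
  exact: (measurableT_comp mg (mZ k)).
pose S : {RV P >-> R} := HB.pack (fun w => spow (p - 2) (X w) * U w)
  (isMeasurableFun.Build _ _ _ _ _ mXU).
pose Y : {RV P >-> R} := HB.pack (fun w => g (Z k w))
  (isMeasurableFun.Build _ _ _ _ _ mY).
have iS : P.-integrable setT (EFin \o S).
  apply: (@integrable_le _ _ _ _ _ (fun w => `|X w| `^ p + `|U w| `^ p)) => //.
    rewrite (_ : _ \o _ = (EFin \o (fun w => `|X w| `^ p)) \+
      (EFin \o (fun w => `|U w| `^ p)))//.
    by apply: integrableD => //; exact: amom_integrable.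
  by move=> w; exact: spow_young.
have := @indep2_integral_centered _ _ _ _ S Y
  (past_indep2 mZ indep kJ pXU mg) iS ig g0.
rewrite /=.
have -> : (fun w => (spow (p - 2) (X w) * U w * g (Z k w))%:E) =
  (fun w => (spow (p - 2) (X w) * (g (Z k w) * U w))%:E).
  by apply/funext => w; congr EFin; ring.
by [].
Qed.

(** Iteration of [smooth_step] along the filtration. The orthogonality
    hypothesis is a weak form of [E(D_k | past) = 0] that avoids conditional
    expectations. *)
Lemma martingale_moment p q (D : 'I_n -> T -> R) (b : 'I_n -> R) :
  p = 2 * q -> 1 <= q ->
  (forall k : 'I_n, past Z (upto n k.+1) (D k)) ->
  (forall k, 0 <= b k) ->
  (forall k, (amom P p (D k) <= (b k `^ q)%:E)%E) ->
  (forall (k : 'I_n) X, past Z (upto n k) X -> (amom P p X < +oo)%E ->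
    (\int[P]_w (spow (p - 2) (X w) * D k w)%:E = 0)%E) ->
  forall m, (amom P p (fun w => (\sum_(j in upto n m) D j w)%R) <=
    ((smooth_const p * \sum_(j in upto n m) b j)%R `^ q)%:E)%E.
Proof.
set K := smooth_const p => pq q1 pD b0 Db orth.
have K0 : 0 <= K by apply: (le_trans ler01); apply: smooth_const_ge1; lra.
elim=> [|m ih].
  rewrite (_ : upto n 0 = finset.set0); last by apply/setP => j; rewrite !inE.
  rewrite big_set0 mulr0 powR0; last lra.
  have p0 : p != 0 by lra.
  rewrite /amom integral0_eq// => w _.
  by rewrite big_set0 normr0 powR0.
case: (ltnP m n) => mn; last first.
  by rewrite (_ : upto n m.+1 = upto n m)//; apply/setP => j; rewrite !inE;
    rewrite !(leq_trans (ltn_ord j))// (leq_trans mn).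
have -> : upto n m.+1 = Ordinal mn |: upto n m by exact: (uptoS (Ordinal mn)).
have mM := @upto_notin n (Ordinal mn).
have -> : (fun w => \sum_(j in Ordinal mn |: upto n m) D j w) =
    (fun w => \sum_(j in upto n m) D j w + D (Ordinal mn) w).
  by apply/funext => w; rewrite big_setU1//= addrC.
have -> : K * \sum_(j in Ordinal mn |: upto n m) b j =
    K * \sum_(j in upto n m) b j + K * b (Ordinal mn).
  by rewrite big_setU1//= addrC mulrDr.
have pS : past Z (upto n m) (fun w => \sum_(j in upto n m) D j w).
  apply: past_sum => j; rewrite inE => jm; apply: past_sub (pD j).
  by apply/fintype.subsetP => i; rewrite !inE ltnS => /leq_ltn_trans; apply.
apply: (smooth_step pq q1) => //.
- exact: past_measurable pS.
- exact: past_measurable (pD _).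
- by rewrite mulr_ge0// sumr_ge0.
- apply: (orth (Ordinal mn)) => //.
  by apply: (le_lt_trans ih); rewrite ltry.
Qed.

End martingale.

(** * Real quadratic forms in independent planar vectors *)

Section chaos.
Context d (T : measurableType d) (R : realType) (P : probability T R).
Let E := (measurableTypeR R * measurableTypeR R)%type.
Context (n : nat) (Z : 'I_n -> T -> E).
Hypothesis mZ : forall i, measurable_fun setT (Z i).
Hypothesis indep : forall (J : {set 'I_n}) B, (forall i, measurable (B i)) ->
  P (box Z J B) = (\prod_(i in J) P (Z i @^-1` B i))%E.
Variables p q : R.
Hypotheses (pq : p = 2 * q) (q1 : 1 <= q).
Let K := smooth_const p.
Implicit Types (a b c s t : R) (f h U : T -> R).

(** For [p = 2 q], [c] bounds the square of the p-norm of [f]. Squares are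
    used because [martingale_moment] bounds them additively. *)
Definition nrm2_le f c := (amom P p f <= (c `^ q)%:E)%E.

Definition sqn (z : E) : R := z.1 ^+ 2 + z.2 ^+ 2.

(** The real part of [(s + i t) conj(z) z']. *)
Definition re_term s t (z z' : E) : R :=
  s * (z.1 * z'.1 + z.2 * z'.2) - t * (z.1 * z'.2 - z.2 * z'.1).

Let p2 : 2 <= p. Proof. by move: q1; rewrite pq => ?; lra. Qed.
Let p0 : 0 <= p. Proof. by move: q1; rewrite pq => ?; lra. Qed.

Let q0 : 0 <= q. Proof. exact: le_trans ler01 q1. Qed.

Let m1 : measurable_fun setT (fun z : E => z.1 : R).
Proof. exact: measurable_fst. Qed.

Let m2 : measurable_fun setT (fun z : E => z.2 : R).
Proof. exact: measurable_snd. Qed.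

Lemma measurable_sqn : measurable_fun setT sqn.
Proof. by apply: measurable_funD; exact: measurable_funX. Qed.

Let msqn : measurable_fun setT sqn := measurable_sqn.

Lemma sqn_ge0 z : 0 <= sqn z.
Proof. by rewrite addr_ge0 ?sqr_ge0. Qed.

Lemma normr_powR_sqr u : `|u| `^ p = (u ^+ 2) `^ q.
Proof. by rewrite pq powRrM (powR_mulrn 2) ?normr_ge0// real_normK// num_real. Qed.

Lemma nrm2_fin f c : nrm2_le f c -> (amom P p f < +oo)%E.
Proof. by move=> H; apply: (le_lt_trans H); rewrite ltry. Qed.

Lemma nrm2_le_trans f c c' : 0 <= c -> c <= c' -> nrm2_le f c -> nrm2_le f c'.
Proof.
move=> c0 cc' H; by apply: (le_trans H); rewrite lee_fin ler_powRl.
Qed.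

(** Cruder than [smooth_step], but no orthogonality is required. *)
Lemma nrm2_add f h a b : measurable_fun setT f -> measurable_fun setT h ->
  0 <= a -> 0 <= b -> nrm2_le f a -> nrm2_le h b ->
  nrm2_le (fun w => f w + h w) (4 * (a + b)).
Proof.
move=> mf mh a0 b0 fa hb.
have mfp := measurable_normpow p mf.
have mhp := measurable_normpow p mh.
have c0 : 0 <= 2 `^ p :> R by exact: powR_ge0.
apply: (@le_trans _ _ ((2 `^ p)%:E * (amom P p f + amom P p h))%E).
  rewrite /amom -ge0_integralD//; [|exact/measurable_EFinP..].
  rewrite -ge0_integralZl//; last 2 first.
  - by apply: emeasurable_funD; exact/measurable_EFinP.
  - by move=> w _; rewrite -EFinD lee_fin addr_ge0 ?powR_ge0.
  apply: ge0_le_integral => //.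
  - apply/measurable_EFinP/measurable_normpow; exact: measurable_funD.
  - apply: emeasurable_funM => //.
    by apply: emeasurable_funD; exact/measurable_EFinP.
  - move=> w _; rewrite -EFinD -EFinM lee_fin.
    apply: (@le_trans _ _ ((`|f w| + `|h w|) `^ p)).
      by rewrite ler_powRl// ler_normD.
    exact: powR_addl.
apply: (@le_trans _ _ ((2 `^ p)%:E * ((a `^ q)%:E + (b `^ q)%:E))%E).
  by rewrite lee_wpmul2l ?lee_fin// leeD.
rewrite -EFinD -EFinM lee_fin powRM ?addr_ge0//.
have -> : 2 `^ p = 4 `^ q :> R.
  rewrite pq powRrM (powR_mulrn 2)//; congr (_ `^ _); ring.
by rewrite ler_wpM2l ?powR_ge0// powR_superadd.
Qed.

Lemma nrm2_prod k (J : {set 'I_n}) U (g : E -> R) a b : k \notin J -> past Z J U ->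
  measurable_fun setT g -> 0 <= a -> 0 <= b ->
  nrm2_le (fun w => g (Z k w)) a -> nrm2_le U b ->
  nrm2_le (fun w => g (Z k w) * U w) (a * b).
Proof.
move=> kJ pU mg a0 b0 ga Ub; rewrite /nrm2_le (amom_product mZ indep p kJ)//.
by rewrite powRM// EFinM lee_pmul ?amom_ge0.
Qed.

Variable gam : R.
Hypothesis gam1 : 1 <= gam.
Hypothesis EZ1 : forall i, (\int[P]_w ((Z i w).1)%:E = 0)%E.
Hypothesis EZ2 : forall i, (\int[P]_w ((Z i w).2)%:E = 0)%E.
Hypothesis EZsq : forall i, (\int[P]_w (sqn (Z i w))%:E = 1)%E.
Hypothesis EZp : forall i, (\int[P]_w (sqn (Z i w) `^ q)%:E <= (gam `^ q)%:E)%E.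
Hypothesis EZ2p : forall i, (\int[P]_w (sqn (Z i w) `^ p)%:E <= (gam `^ p)%:E)%E.

Let gam0 : 0 <= gam. Proof. exact: le_trans ler01 gam1. Qed.

Let mg (g : E -> R) i : measurable_fun setT g -> measurable_fun setT (fun w => g (Z i w)).
Proof. by move=> m; exact: (measurableT_comp m (mZ i)). Qed.

Let isqn i : P.-integrable setT (fun w => (sqn (Z i w))%:E).
Proof.
apply/integrableP; split; first by apply/measurable_EFinP; exact: mg.
under eq_integral do rewrite gee0_abs ?lee_fin ?sqn_ge0//.
by rewrite EZsq ltry.
Qed.

Let idom i (g : E -> R) : measurable_fun setT g ->
  (forall z, `|g z| <= 1 + sqn z) -> P.-integrable setT (fun w => (g (Z i w))%:E).
Proof.
move=> m H; apply: (@integrable_le _ _ _ P _ (fun w => 1 + sqn (Z i w))).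
- exact: mg.
- rewrite (_ : _ \o _ = (EFin \o cst 1) \+ (EFin \o (fun w => sqn (Z i w))))//.
  apply: integrableD => //; last exact: isqn.
  exact: finite_measure_integrable_cst.
- by move=> w; exact: H.
Qed.

Lemma integrable_fst i : P.-integrable setT (fun w => ((Z i w).1 : R)%:E).
Proof.
apply: (@idom i (fun z : E => z.1)) => // z; rewrite /sqn ler_norml.
have := sqr_ge0 (z.2 : R); have := sqr_ge0 ((z.1 : R) - 1).
have := sqr_ge0 ((z.1 : R) + 1); nra.
Qed.

Lemma integrable_snd i : P.-integrable setT (fun w => ((Z i w).2 : R)%:E).
Proof.
apply: (@idom i (fun z : E => z.2)) => // z; rewrite /sqn ler_norml.
have := sqr_ge0 (z.1 : R); have := sqr_ge0 ((z.2 : R) - 1).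
have := sqr_ge0 ((z.2 : R) + 1); nra.
Qed.

Let idiag i : P.-integrable setT (fun w => (sqn (Z i w) - 1)%:E).
Proof.
apply: (@idom i (fun z : E => sqn z - 1)) => [|z].
  by apply: measurable_funB.
by rewrite ler_norml; have := sqn_ge0 z; lra.
Qed.

Let Ed i : (\int[P]_w (sqn (Z i w) - 1)%:E = 0)%E.
Proof.
under eq_integral do rewrite EFinB.
rewrite integralB_EFin//; [|exact: isqn|exact: finite_measure_integrable_cst].
by rewrite EZsq integral_cst// mul1e [X in (_ - X)%E]probability_setT subee.
Qed.

(** Cauchy-Schwarz in the plane: [(s x + t y)^2 <= (s^2 + t^2) (x^2 + y^2)]. *)
Lemma nrm2_pair i s t :
  nrm2_le (fun w => s * (Z i w).1 + t * (Z i w).2) (gam * (s ^+ 2 + t ^+ 2)).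
Proof.
have st0 : 0 <= s ^+ 2 + t ^+ 2 by rewrite addr_ge0 ?sqr_ge0.
have mq : measurable_fun setT (fun w => sqn (Z i w) `^ q).
  by apply: (measurableT_comp (measurable_powR q)); exact: mg.
apply: (@le_trans _ _ (((s ^+ 2 + t ^+ 2) `^ q)%:E *
    \int[P]_w (sqn (Z i w) `^ q)%:E)%E).
  rewrite -ge0_integralZl ?lee_fin ?powR_ge0//; last 2 first.
  - exact/measurable_EFinP.
  - by move=> w _; rewrite lee_fin powR_ge0.
  apply: ge0_le_integral => //.
  - apply/measurable_EFinP; apply: measurable_normpow.
    by apply: measurable_funD; apply: measurable_funM => //; exact: mg.
  - apply/(measurable_EFinP setT (fun w => (s ^+ 2 + t ^+ 2) `^ q * sqn (Z i w) `^ q)).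
    exact: measurable_funM.
  - move=> w _; rewrite -EFinM lee_fin normr_powR_sqr -powRM ?sqn_ge0//.
    rewrite ler_powRl ?sqr_ge0//.
    rewrite /sqn; have := sqr_ge0 (s * (Z i w).2 - t * (Z i w).1); nra.
rewrite powRM//.
by rewrite EFinM muleC lee_wpmul2r ?lee_fin ?powR_ge0.
Qed.

(** Both [|z|^2] and the constant 1 have squared p-norm at most [gam^2], and
    8 is the factor 4 of [nrm2_add] times 2. *)
Lemma nrm2_diag i c :
  nrm2_le (fun w => (sqn (Z i w) - 1) * c) (8 * gam ^+ 2 * c ^+ 2).
Proof.
have E1 : ((gam ^+ 2) `^ q) = gam `^ p.
  by rewrite -normr_powR_sqr ger0_norm.
have H1 : nrm2_le (fun w => sqn (Z i w)) (gam ^+ 2).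
  rewrite /nrm2_le /amom; under eq_integral do rewrite (ger0_norm (sqn_ge0 _)).
  by rewrite E1.
have H2 : nrm2_le (fun _ => -1) (gam ^+ 2).
  rewrite /nrm2_le /amom normrN1 powR1 integral_cst// mul1e [X in (X <= _)%E]probability_setT.
  rewrite lee_fin E1 (_ : 1 = 1 `^ p :> R); last by rewrite powR1.
  exact: ler_powRl.
have g2 : 0 <= gam ^+ 2 by exact: sqr_ge0.
have H := nrm2_add (mg i msqn) (measurable_cst _) g2 g2 H1 H2.
have mq : measurable_fun setT (fun w => sqn (Z i w) - 1).
  by apply: measurable_funB => //; exact: mg.
rewrite /nrm2_le /amom.
under eq_integral do rewrite normrM powRM// EFinM.
rewrite ge0_integralZr//; last by apply/measurable_EFinP; exact: measurable_normpow.
rewrite normr_powR_sqr powRM ?sqr_ge0//; last by rewrite mulr_ge0.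
rewrite EFinM lee_wpmul2r ?lee_fin ?powR_ge0//.
have -> : 8 * gam ^+ 2 = 4 * (gam ^+ 2 + gam ^+ 2) by ring.
exact: H.
Qed.

Let K1 : 1 <= K. Proof. exact: smooth_const_ge1. Qed.

Let past_pair (J : {set 'I_n}) i s t : i \in J ->
  past Z J (fun w => s * (Z i w).1 + t * (Z i w).2).
Proof.
move=> iJ; apply: (@past_coord _ _ R _ _ _ Z J i (fun z : E => s * z.1 + t * z.2)) => //.
by apply: measurable_funD; apply: measurable_funM.
Qed.

Section linear.
Variables s t : 'I_n -> R.

Let D i w := s i * (Z i w).1 + t i * (Z i w).2.
Let b i := gam * (s i ^+ 2 + t i ^+ 2).

Lemma linear_form m :
  nrm2_le (fun w => \sum_(j in upto n m) (s j * (Z j w).1 + t j * (Z j w).2))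
    (K * \sum_(j in upto n m) (gam * (s j ^+ 2 + t j ^+ 2))).
Proof.
apply: (@martingale_moment _ _ R P _ _ n Z mZ p q D b pq q1).
- by move=> k; apply: past_pair; rewrite inE.
- by move=> k; rewrite mulr_ge0// addr_ge0 ?sqr_ge0.
- by move=> k; exact: nrm2_pair.
move=> k X pX Xoo.
have c0 c : past Z (upto n k) (fun _ => c) by exact: measurable_cst.
have coo c : (amom P p (fun _ => c) < +oo)%E.
  by rewrite /amom integral_cst// [X in (_ * X)%E]probability_setT mule1 ltry.
have kN := upto_notin k.
have [i1 e1] := centered_orth mZ indep p2 kN pX (c0 (s k)) m1
  (integrable_fst k) (EZ1 k) Xoo (coo _).
have [i2 e2] := centered_orth mZ indep p2 kN pX (c0 (t k)) m2
  (integrable_snd k) (EZ2 k) Xoo (coo _).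
rewrite (_ : (fun w => _) = (fun w =>
   (spow (p - 2) (X w) * ((Z k w).1 * s k))%:E +
   (spow (p - 2) (X w) * ((Z k w).2 * t k))%:E)%E); last first.
  by apply/funext => w; rewrite -EFinD /D; congr EFin; ring.
by rewrite integralD// e1 e2 adde0.
Qed.

End linear.

Section quadratic.
Variables A B : 'I_n -> 'I_n -> R.

Let F i j w := re_term (A i j) (B i j) (Z i w) (Z j w).

(* [U k] and [V k] collect the coefficients of the two coordinates of [Z k] in
   the terms that pair [k] with a smaller index. *)
Let U (k : 'I_n) w := \sum_(j in upto n k)
  ((A k j + A j k) * (Z j w).1 + (B j k - B k j) * (Z j w).2).
Let V (k : 'I_n) w := \sum_(j in upto n k)
  ((B k j - B j k) * (Z j w).1 + (A k j + A j k) * (Z j w).2).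
Let D (k : 'I_n) w := (sqn (Z k w) - 1) * A k k + ((Z k w).1 * U k w + (Z k w).2 * V k w).

Let DE w : \sum_i \sum_j F i j w - \sum_i A i i = \sum_(k in upto n n) D k w.
Proof.
rewrite sum_triangular (_ : upto n n = [set: 'I_n]%SET); last first.
  by apply/setP => i; rewrite !inE ltn_ord.
under [RHS]eq_bigl do rewrite inE.
rewrite -sumrB; apply: eq_bigr => k _.
have -> : F k k w = sqn (Z k w) * A k k by rewrite /F /re_term /sqn; ring.
rewrite /D /U /V !mulr_sumr -big_split /= mulrBl mul1r.
rewrite -[LHS]addrA [X in _ + X]addrC addrA; congr (_ + _).
by apply: eq_bigr => j _; rewrite /F /re_term; ring.
Qed.

Let S (k : 'I_n) :=
  \sum_(j in upto n k) (A k j ^+ 2 + B k j ^+ 2 + (A j k ^+ 2 + B j k ^+ 2)).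
(* Two applications of [nrm2_add] bound the squared p-norm of [D k] by
   [gam^2 (32 A_kk^2 + 64 K S k)]; the constant 128 covers both terms. *)
Let b (k : 'I_n) := 128 * K * gam ^+ 2 * ((A k k ^+ 2 + B k k ^+ 2) + S k).

Let pU (k : 'I_n) : past Z (upto n k) (U k).
Proof. by apply: past_sum => j jk; exact: past_pair. Qed.

Let pV (k : 'I_n) : past Z (upto n k) (V k).
Proof. by apply: past_sum => j jk; exact: past_pair. Qed.

Let nUV (s t : 'I_n -> R) (k : 'I_n) : (forall j, s j ^+ 2 + t j ^+ 2 <=
    2 * (A k j ^+ 2 + B k j ^+ 2 + (A j k ^+ 2 + B j k ^+ 2))) ->
  nrm2_le (fun w => \sum_(j in upto n k) (s j * (Z j w).1 + t j * (Z j w).2))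
    (2 * K * gam * S k).
Proof.
move=> H; have K0 : 0 <= K := le_trans ler01 K1.
apply: nrm2_le_trans (linear_form s t k).
  by rewrite mulr_ge0// sumr_ge0// => j _; rewrite mulr_ge0// addr_ge0 ?sqr_ge0.
have -> : 2 * K * gam * S k = K * (gam * (2 * S k)) by ring.
rewrite ler_wpM2l// -mulr_sumr ler_wpM2l// /S mulr_sumr.
by apply: ler_sum => j _; exact: H.
Qed.

(** The martingale inequality is used twice: through [linear_form] for the
    coefficients [U k] and [V k], and then for the differences [D k]. *)
Lemma quadratic_chaos :
  nrm2_le (fun w =>
      \sum_i \sum_j re_term (A i j) (B i j) (Z i w) (Z j w) - \sum_i A i i)
    (K * (128 * K * gam ^+ 2 * \sum_i \sum_j (A i j ^+ 2 + B i j ^+ 2))).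
Proof.
have K0 : 0 <= K := le_trans ler01 K1.
have AB0 i j : 0 <= A i j ^+ 2 + B i j ^+ 2 by rewrite addr_ge0 ?sqr_ge0.
have S0 k : 0 <= S k by apply: sumr_ge0 => j _; rewrite addr_ge0.
rewrite (_ : (fun w => _) =
    (fun w => \sum_(k in upto n n) D k w)); last by apply/funext => w; exact: DE.
have -> : 128 * K * gam ^+ 2 * \sum_i \sum_j (A i j ^+ 2 + B i j ^+ 2) =
    \sum_(k in upto n n) b k.
  rewrite sum_triangular /b -mulr_sumr; congr (_ * _).
  by apply: eq_bigl => k; rewrite inE ltn_ord.
have nU k : nrm2_le (U k) (2 * K * gam * S k).
  by apply: nUV => j; have := sqr_ge0 (A k j - A j k);
    have := sqr_ge0 (B j k + B k j); nra.
have nV k : nrm2_le (V k) (2 * K * gam * S k).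
  by apply: nUV => j; have := sqr_ge0 (A k j - A j k);
    have := sqr_ge0 (B j k + B k j); nra.
have n1 k : nrm2_le (fun w => (Z k w).1) gam.
  have := nrm2_pair k 1 0; rewrite expr1n expr0n addr0 mulr1.
  by under eq_fun do rewrite mul1r mul0r addr0.
have n2 k : nrm2_le (fun w => (Z k w).2) gam.
  have := nrm2_pair k 0 1; rewrite expr1n expr0n add0r mulr1.
  by under eq_fun do rewrite mul1r mul0r add0r.
have kN := @upto_notin n.
have KS0 k : 0 <= 2 * K * gam * S k
  by rewrite mulr_ge0// mulr_ge0// mulr_ge0.
apply: (@martingale_moment _ _ R P _ _ n Z mZ p q D b pq q1).
- move=> k; have kk : k \in upto n k.+1 by rewrite inE.
  have sub : upto n k \subset upto n k.+1 by rewrite uptoS; exact: subsetU1.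
  apply: measurable_funD.
    apply: (@past_coord _ _ R _ _ _ Z _ k (fun z : E => (sqn z - 1) * A k k)) => //.
    by apply: measurable_funM => //; exact: measurable_funB.
  apply: measurable_funD; apply: measurable_funM.
  + exact: (@past_coord _ _ R _ _ _ Z _ k (fun z : E => z.1)).
  + exact: past_sub sub (@pU k).
  + exact: (@past_coord _ _ R _ _ _ Z _ k (fun z : E => z.2)).
  + exact: past_sub sub (@pV k).
- move=> k; rewrite /b mulr_ge0 ?addr_ge0 ?sqr_ge0//.
  by rewrite mulr_ge0 ?sqr_ge0// mulr_ge0.
- move=> k.
  have mU := past_measurable mZ (@pU k); have mV := past_measurable mZ (@pV k).
  have mx := mg k m1; have my := mg k m2.
  have mxU := measurable_funM mx mU; have myV := measurable_funM my mV.
  have gS0 : 0 <= gam * (2 * K * gam * S k) by rewrite mulr_ge0.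
  have d0 : 0 <= 8 * gam ^+ 2 * A k k ^+ 2.
    by rewrite mulr_ge0 ?sqr_ge0// mulr_ge0 ?sqr_ge0.
  have g40 : 0 <= 4 * (gam * (2 * K * gam * S k) + gam * (2 * K * gam * S k)).
    by rewrite mulr_ge0// addr_ge0.
  have md : measurable_fun setT (fun w => (sqn (Z k w) - 1) * A k k).
    by apply: measurable_funM => //; apply: measurable_funB => //; exact: mg.
  have HU := nrm2_prod (kN k) (@pU k) m1 gam0 (KS0 k) (n1 k) (nU k).
  have HV := nrm2_prod (kN k) (@pV k) m2 gam0 (KS0 k) (n2 k) (nV k).
  have HUV := nrm2_add mxU myV gS0 gS0 HU HV.
  have := nrm2_add md (measurable_funD mxU myV) d0 g40 (nrm2_diag k (A k k)) HUV.
  apply: nrm2_le_trans; first by rewrite mulr_ge0// addr_ge0.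
  rewrite /b.
  have -> : 4 * (8 * gam ^+ 2 * A k k ^+ 2 +
     4 * (gam * (2 * K * gam * S k) + gam * (2 * K * gam * S k))) =
     gam ^+ 2 * (32 * A k k ^+ 2 + 64 * (K * S k)) by ring.
  have -> : 128 * K * gam ^+ 2 * (A k k ^+ 2 + B k k ^+ 2 + S k) =
     gam ^+ 2 * (128 * (K * A k k ^+ 2) + 128 * (K * B k k ^+ 2) + 128 * (K * S k)).
    by ring.
  rewrite ler_wpM2l ?sqr_ge0//.
  have h1 : A k k ^+ 2 <= K * A k k ^+ 2 by rewrite ler_peMl ?sqr_ge0.
  have h2 : 0 <= K * B k k ^+ 2 by rewrite mulr_ge0 ?sqr_ge0.
  have h3 : 0 <= K * S k by rewrite mulr_ge0.
  have h4 : 0 <= A k k ^+ 2 by rewrite sqr_ge0.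
  lra.
move=> k X pX Xoo.
have c0 c : past Z (upto n k) (fun _ => c) by exact: measurable_cst.
have coo c : (amom P p (fun _ => c) < +oo)%E.
  by rewrite /amom integral_cst// [X in (_ * X)%E]probability_setT mule1 ltry.
have md : measurable_fun setT (fun z => sqn z - 1) by exact: measurable_funB.
have [i0 e0] := centered_orth mZ indep p2 (kN k) pX (c0 (A k k)) md (idiag k) (Ed k)
  Xoo (coo _).
have [i1 e1] := centered_orth mZ indep p2 (kN k) pX (@pU k) m1
  (integrable_fst k) (EZ1 k) Xoo (nrm2_fin (nU k)).
have [i2 e2] := centered_orth mZ indep p2 (kN k) pX (@pV k) m2
  (integrable_snd k) (EZ2 k) Xoo (nrm2_fin (nV k)).
rewrite (_ : (fun w => _) = (fun w =>
   (spow (p - 2) (X w) * ((sqn (Z k w) - 1) * A k k))%:E +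
   ((spow (p - 2) (X w) * ((Z k w).1 * U k w))%:E +
   (spow (p - 2) (X w) * ((Z k w).2 * V k w))%:E))%E); last first.
  by apply/funext => w; rewrite -!EFinD /D; congr EFin; ring.
rewrite integralD//; last exact: integrableD.
by rewrite integralD// e0 e1 e2 !adde0.
Qed.

End quadratic.

End chaos.

(** * Moments of a nonnegative function *)

Section moment_comparison.
Context d (T : measurableType d) (R : realType) (P : probability T R).
Implicit Types (f : T -> R) (p q g : R).

(** Jensen's inequality, from the tangent [1 + p (t - 1)] of [t^p] at 1. *)
Lemma one_le_moment f p : measurable_fun setT f -> (forall w, 0 <= f w) ->
  1 <= p -> (\int[P]_w (f w)%:E = 1)%E -> (1 <= \int[P]_w (f w `^ p)%:E)%E.
Proof.
move=> mf f0 p1 f1.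
have mfp := measurable_powR_comp p mf.
have p0 : 0 < p by lra.
have H : (p%:E * 1 <= \int[P]_w (f w `^ p)%:E + (p - 1)%:E)%E.
  rewrite -f1 -ge0_integralZl//; [|exact/measurable_EFinP|by move=> w _; rewrite lee_fin
    |by rewrite lee_fin ltW].
  rewrite -[X in (_ <= _ + X)%E](_ : \int[P]_w (p - 1)%:E = _)%E; last first.
    by rewrite integral_cst// [X in (_ * X)%E]probability_setT mule1.
  rewrite -ge0_integralD//; last 3 first.
  - by move=> w _; rewrite lee_fin powR_ge0.
  - exact/measurable_EFinP.
  - by move=> w _; rewrite lee_fin subr_ge0.
  apply: ge0_le_integral => //.
  - by move=> w _; rewrite -EFinM lee_fin mulr_ge0// ltW.
  - apply/(measurable_EFinP setT (fun w => p * f w)); exact: measurable_funM.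
  - apply/(measurable_EFinP setT (fun w => f w `^ p + (p - 1))).
    exact: measurable_funD.
  - move=> w _; rewrite -EFinM -EFinD lee_fin.
    have := @powR_tangent R (f w) 1 p p1 (f0 w) ler01.
    rewrite !powR1; lra.
move: H; case: (\int[P]_w (f w `^ p)%:E)%E => [r| |];
  [|by rewrite !leey|by rewrite mule1 addNye leeNy_eq].
by rewrite mule1 -EFinD !lee_fin; lra.
Qed.

(** Integrated form of [2 u <= u^2 / s + s] with [u = f^q] and [s = g^q]. *)
Lemma half_moment f q g : measurable_fun setT f -> (forall w, 0 <= f w) -> 0 < g ->
  (\int[P]_w (f w `^ (2 * q))%:E <= (g `^ (2 * q))%:E)%E ->
  (\int[P]_w (f w `^ q)%:E <= (g `^ q)%:E)%E.
Proof.
move=> mf f0 g0 H.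
have mfp := measurable_powR_comp (2 * q) mf.
have mfq := measurable_powR_comp q mf.
have sq x : x `^ (2 * q) = (x `^ q) ^+ 2.
  by rewrite mulrC powRrM powR_mulrn ?powR_ge0.
set s := g `^ q; have s0 : 0 < s by rewrite powR_gt0.
have HH : (2%:E * \int[P]_w (f w `^ q)%:E <=
    s^-1%:E * \int[P]_w (f w `^ (2 * q))%:E + s%:E)%E.
  have si0 : 0 <= s^-1 by rewrite invr_ge0 ltW.
  rewrite -ge0_integralZl//; [|exact/measurable_EFinP|by move=> w _; rewrite lee_fin powR_ge0].
  rewrite -ge0_integralZl//; [|exact/measurable_EFinP|by move=> w _; rewrite lee_fin powR_ge0].
  rewrite -[X in (_ <= _ + X)%E](_ : \int[P]_w s%:E = _)%E; last first.
    by rewrite integral_cst// [X in (_ * X)%E]probability_setT mule1.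
  rewrite -ge0_integralD//.
  - apply: ge0_le_integral => //.
    + by move=> w _; rewrite -EFinM lee_fin mulr_ge0// powR_ge0.
    + apply/(measurable_EFinP setT (fun w => 2 * f w `^ q)); exact: measurable_funM.
    + apply/(measurable_EFinP setT (fun w => s^-1 * f w `^ (2 * q) + s)).
      by apply: measurable_funD => //; exact: measurable_funM.
    + move=> w _; rewrite -!EFinM -EFinD lee_fin sq -(ler_pM2l s0) mulrDr (mulrA s s^-1).
      rewrite divff ?gt_eqF// mul1r; have := sqr_ge0 (f w `^ q - s); nra.
  - by move=> w _; rewrite -EFinM lee_fin mulr_ge0// powR_ge0.
  - apply/(measurable_EFinP setT (fun w => s^-1 * f w `^ (2 * q))).
    exact: measurable_funM.
  - by move=> w _; rewrite lee_fin ltW.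
have {}HH := le_trans HH (leeD2r s%:E (lee_wpmul2l (_ : 0 <= s^-1%:E)%E H)).
have : (2%:E * \int[P]_w (f w `^ q)%:E <= (2 * s)%:E)%E.
  apply: (le_trans (HH _)); first by rewrite lee_fin invr_ge0 ltW.
  rewrite sq -/s -EFinM -EFinD lee_fin expr2 mulrA mulVf ?gt_eqF//; lra.
by rewrite EFinM lee_pmul2l// lte_fin.
Qed.

End moment_comparison.

(** * From complex to real quadratic forms *)

Section complex_plane.
Context {R : realType}.
Implicit Types z : R[i].

Lemma normc_powR z (r : R) : normc z `^ (2 * r) = sqn (plane z) `^ r.
Proof.
rewrite powRrM (powR_mulrn 2); last by case: z => x y; exact: sqrtr_ge0.
by case: z => x y; rewrite /sqn /= sqr_sqrtr// addr_ge0 ?sqr_ge0.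
Qed.

Lemma normc_ge0 z : 0 <= normc z.
Proof. by case: z => x y; exact: sqrtr_ge0. Qed.

Lemma normc_le_ReIm z : normc z <= `|complex.Re z| + `|complex.Im z|.
Proof.
case: z => x y /=; rewrite -[leRHS]ger0_norm ?addr_ge0// -sqrtr_sqr ler_wsqrtr//.
rewrite sqrrD !real_normK ?num_real// addrAC lerDl mulrn_wge0// mulr_ge0//.
Qed.

Lemma Re_sum (I : Type) (r : seq I) (Q : pred I) (F : I -> R[i]) :
  complex.Re (\sum_(i <- r | Q i) F i) = \sum_(i <- r | Q i) complex.Re (F i).
Proof. by apply: (big_morph (@complex.Re R)) => // -[x1 y1] [x2 y2]. Qed.

Lemma Im_sum (I : Type) (r : seq I) (Q : pred I) (F : I -> R[i]) :
  complex.Im (\sum_(i <- r | Q i) F i) = \sum_(i <- r | Q i) complex.Im (F i).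
Proof. by apply: (big_morph (@complex.Im R)) => // -[x1 y1] [x2 y2]. Qed.

Lemma quad_formE n (M : 'M[R[i]]_n) (v : 'cV[R[i]]_n) :
  quad_form M v = \sum_i \sum_j (conjc (v i ord0) * M i j * v j ord0).
Proof.
rewrite /quad_form mxE exchange_big; apply: eq_bigr => j _ /=.
by rewrite mxE mulr_suml; apply: eq_bigr => i _; rewrite !mxE.
Qed.

Lemma Re_quad_form n (M : 'M[R[i]]_n) (v : 'cV[R[i]]_n) :
  complex.Re (quad_form M v) = \sum_i \sum_j
    re_term (complex.Re (M i j)) (complex.Im (M i j))
      (plane (v i ord0)) (plane (v j ord0)).
Proof.
rewrite quad_formE Re_sum; apply: eq_bigr => i _; rewrite Re_sum.
apply: eq_bigr => j _; rewrite /re_term /=.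
by case: (v i ord0) => x y; case: (v j ord0) => x' y'; case: (M i j) => a b /=; ring.
Qed.

(** [Im z = Re (- i z)], and [- i (s + i t) = t - i s]. *)
Lemma Im_quad_form n (M : 'M[R[i]]_n) (v : 'cV[R[i]]_n) :
  complex.Im (quad_form M v) = \sum_i \sum_j
    re_term (complex.Im (M i j)) (- complex.Re (M i j))
      (plane (v i ord0)) (plane (v j ord0)).
Proof.
rewrite quad_formE Im_sum; apply: eq_bigr => i _; rewrite Im_sum.
apply: eq_bigr => j _; rewrite /re_term /=.
by case: (v i ord0) => x y; case: (v j ord0) => x' y'; case: (M i j) => a b /=; ring.
Qed.

Lemma frobenius_powR n (M : 'M[R[i]]_n) (q : R) :
  frobenius_norm M `^ (2 * q) =
  (\sum_i \sum_j (complex.Re (M i j) ^+ 2 + complex.Im (M i j) ^+ 2)) `^ q.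
Proof.
rewrite powRrM (powR_mulrn 2) ?sqrtr_ge0// sqr_sqrtr; last first.
  by apply: sumr_ge0 => i _; apply: sumr_ge0 => j _; exact: sqr_ge0.
congr (_ `^ _); apply: eq_bigr => i _; apply: eq_bigr => j _.
by case: (M i j) => x y /=; rewrite sqr_sqrtr// addr_ge0 ?sqr_ge0.
Qed.

End complex_plane.

Theorem proposition4 (R : realType) (p : R) (hp : 2 <= p) :
  exists C : R,
  forall (d : measure_display) (T : measurableType d) (P : probability T R)
    (n : nat) (a : T -> 'cV[R[i]]_n),
  (forall i : 'I_n, complex_rv (fun w => a w i ord0)) ->
  independent_crvs P (fun (i : 'I_n) w => a w i ord0) ->
  (forall i : 'I_n, cexpectation P (fun w => a w i ord0) = 0) ->
  (forall i : 'I_n, abs_moment P (fun w => a w i ord0) 2 = 1%E) ->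
  (max_abs_moment P a (2 * p) < +oo)%E ->
  forall M : 'M[R[i]]_n,
  (abs_moment P (fun w => quad_form M (a w)) p <=
   C%:E * ((normc (\tr M) `^ p)%:E
           + max_abs_moment P a (2 * p) * (frobenius_norm M `^ p)%:E))%E.
Proof.
pose q := p / 2; have pq : p = 2 * q by rewrite /q; field.
have q1 : 1 <= q by lra.
have q0 : 0 <= q by lra.
pose K := smooth_const p.
have K0 : 0 <= K by apply: (le_trans ler01); exact: smooth_const_ge1.
(* [L gam^2 ||M||_F^2] is 8 times the squared p-norm bound [c] of each of the
   real and imaginary parts of [a^* M a - Tr M]; the outer factor [8^q] of the
   constant comes from splitting off the trace. *)
pose L := 8 * (K * (128 * K)).
exists (8 `^ q * (1 + L `^ q)) => d T P n a ma ia Ea Va aoo M.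
have L0 : 0 <= L by rewrite /L mulr_ge0// mulr_ge0// mulr_ge0.
have C0 : 0 <= 8 `^ q * (1 + L `^ q) by rewrite mulr_ge0 ?addr_ge0 ?powR_ge0.
set alpha := max_abs_moment P a (2 * p).
have alpha0 : (0 <= alpha)%E by exact: bigmax_ge_id.
have RHS0 : (0 <= (normc (\tr M) `^ p)%:E + alpha * (frobenius_norm M `^ p)%:E)%E.
  by rewrite adde_ge0 ?mule_ge0 ?lee_fin ?powR_ge0.
(* without coordinates the maximal moment is 0 rather than at least 1 *)
case: (posnP n) => [n0|n0].
  rewrite (_ : abs_moment _ _ _ = 0%E); first by rewrite mule_ge0.
  rewrite /abs_moment unlock integral0_eq// => w _.
  rewrite quad_formE big1 ?normc0 ?powR0//; first by lra.
  by move=> i; have := ltn_ord i; rewrite [X in (_ < X)%N]n0.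
pose Z (i : 'I_n) w := plane (a w i ord0).
have mZ i : measurable_fun setT (Z i) by exact: ma.
have indep (J : {set 'I_n}) B : (forall i, measurable (B i)) ->
    P (box Z J B) = (\prod_(i in J) P (Z i @^-1` B i))%E by exact: ia.
have msq i : measurable_fun setT (fun w => sqn (Z i w)).
  exact: (measurableT_comp (@measurable_sqn R) (mZ i)).
have EZsq i : (\int[P]_w (sqn (Z i w))%:E = 1)%E.
  rewrite -(Va i) /abs_moment unlock; apply: eq_integral => w _.
  by rewrite -[X in _ `^ X]mulr1 normc_powR powRr1 ?sqn_ge0.
have Ealpha i : (\int[P]_w (sqn (Z i w) `^ p)%:E <= alpha)%E.
  apply: (@le_trans _ _ (abs_moment P (fun w => a w i ord0) (2 * p))); last first.
    exact: (le_bigmax _ (fun i => abs_moment P (fun w => a w i ord0) (2 * p))).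
  rewrite /abs_moment unlock; apply: ge0_le_integral => //.
  - by move=> w _; rewrite lee_fin powR_ge0.
  - by apply/measurable_EFinP; exact: measurable_powR_comp.
  - apply/measurable_EFinP.
    under eq_fun do rewrite normc_powR.
    exact: (measurable_powR_comp p (msq i)).
  - by move=> w _; rewrite normc_powR.
have EZ1 i : (\int[P]_w ((Z i w).1)%:E = 0)%E.
  have := Ea i; rewrite /cexpectation unlock => /eqP; rewrite eq_complex /=.
  move=> /andP[/eqP e1 _]; rewrite -[RHS]/((0 : R)%:E) -e1 fineK//.
  exact: integrable_fin_num (integrable_fst mZ EZsq i).
have EZ2 i : (\int[P]_w ((Z i w).2)%:E = 0)%E.
  have := Ea i; rewrite /cexpectation unlock => /eqP; rewrite eq_complex /=.
  move=> /andP[_ /eqP e1]; rewrite -[RHS]/((0 : R)%:E) -e1 fineK//.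
  exact: integrable_fin_num (integrable_snd mZ EZsq i).
have alphaE : alpha = (fine alpha)%:E by rewrite fineK// ge0_fin_numE.
have alpha1 : 1 <= fine alpha.
  rewrite -lee_fin -alphaE; apply: le_trans (Ealpha (Ordinal n0)).
  by apply: one_le_moment => //; [move=> w; exact: sqn_ge0|lra].
(* normalised so that [gam^p] is the maximal moment of order 2p *)
pose gam := fine alpha `^ p^-1.
have gamp : gam `^ p = fine alpha.
  by rewrite /gam -powRrM mulVf ?powRr1//; lra.
have gam1 : 1 <= gam.
  rewrite /gam (_ : 1 = 1 `^ p^-1 :> R); last by rewrite powR1.
  by rewrite ler_powRl// invr_ge0; lra.
have EZ2p i : (\int[P]_w (sqn (Z i w) `^ p)%:E <= (gam `^ p)%:E)%E.
  by rewrite gamp -alphaE.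
have EZp i : (\int[P]_w (sqn (Z i w) `^ q)%:E <= (gam `^ q)%:E)%E.
  apply: half_moment => //; [by move=> w; exact: sqn_ge0|by lra|].
  by rewrite -pq.
pose A i j := complex.Re (M i j); pose B i j := complex.Im (M i j).
pose S := \sum_i \sum_j (A i j ^+ 2 + B i j ^+ 2).
have HA := quadratic_chaos mZ indep pq q1 gam1 EZ1 EZ2 EZsq EZp EZ2p A B.
have HB := quadratic_chaos mZ indep pq q1 gam1 EZ1 EZ2 EZsq EZp EZ2p B
  (fun i j => - A i j).
pose trA := \sum_i A i i; pose trB := \sum_i B i i.
pose f1 w := \sum_i \sum_j re_term (A i j) (B i j) (Z i w) (Z j w) - trA.
pose f2 w := \sum_i \sum_j re_term (B i j) (- A i j) (Z i w) (Z j w) - trB.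
pose c := K * (128 * K * gam ^+ 2 * S).
have {}HA : nrm2_le P p q f1 c by exact: HA.
have {}HB : nrm2_le P p q f2 c.
  rewrite (_ : c = K * (128 * K * gam ^+ 2 *
    \sum_i \sum_j (B i j ^+ 2 + (- A i j) ^+ 2))) ?HB//.
  do 2 congr (_ * _); apply: eq_bigr => i _; apply: eq_bigr => j _.
  by rewrite sqrrN addrC.
have mterm s t i j : measurable_fun setT (fun w => re_term s t (Z i w) (Z j w)).
  have mx k : measurable_fun setT (fun w => (Z k w).1 : R).
    exact: (measurableT_comp measurable_fst (mZ k)).
  have my k : measurable_fun setT (fun w => (Z k w).2 : R).
    exact: (measurableT_comp measurable_snd (mZ k)).
  apply: measurable_funB; apply: measurable_funM => //.
    by apply: measurable_funD; exact: measurable_funM.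
  by apply: measurable_funB; exact: measurable_funM.
have mf1 : measurable_fun setT f1.
  by apply: measurable_funB => //; do 2 (apply: measurable_sum => ?).
have mf2 : measurable_fun setT f2.
  by apply: measurable_funB => //; do 2 (apply: measurable_sum => ?).
have quadE w : quad_form M (a w) = (f1 w +i* f2 w)%C + \tr M.
  apply/eqP; rewrite eq_complex; apply/andP; split; apply/eqP.
    by rewrite Re_quad_form /mxtrace raddfD /= Re_sum subrK.
  by rewrite Im_quad_form /mxtrace raddfD /= Im_sum subrK.
set t := normc (\tr M); have t0 : 0 <= t by exact: normc_ge0.
have S0 : 0 <= S.
  by apply: sumr_ge0 => i _; apply: sumr_ge0 => j _; rewrite addr_ge0 ?sqr_ge0.
have cE : 8 * c = L * (gam ^+ 2 * S) by rewrite /c /L; ring.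
have c0 : 0 <= c
  by rewrite -(pmulr_rge0 c (ltr0Sn R 7)) cE mulr_ge0 ?L0// mulr_ge0 ?sqr_ge0.
have Ht : nrm2_le P p q (fun=> t) (t ^+ 2).
  rewrite /nrm2_le /amom integral_cst// [X in (_ * X)%E]probability_setT mule1.
  by rewrite (normr_powR_sqr pq).
have Habs f : nrm2_le P p q f c -> nrm2_le P p q (fun w => `|f w|) c.
  by rewrite /nrm2_le /amom; under [X in _ -> (X <= _)%E]eq_integral do rewrite normr_id.
have mabs (f : T -> R) : measurable_fun setT f -> measurable_fun setT (fun w => `|f w|).
  by move=> mf; exact: measurableT_comp.
have H12 := nrm2_add pq q1 (mabs _ mf1) (mabs _ mf2) c0 c0 (Habs _ HA) (Habs _ HB).
have c4 : 0 <= 4 * (c + c) by rewrite mulr_ge0 ?addr_ge0.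
have H3 := nrm2_add pq q1 (measurable_cst t)
  (measurable_funD (mabs _ mf1) (mabs _ mf2)) (sqr_ge0 t) c4 Ht H12.
apply: (@le_trans _ _ (amom P p (fun w => t + (`|f1 w| + `|f2 w|))%R)).
  rewrite /abs_moment unlock; apply: ge0_le_integral => //.
  - by move=> w _; rewrite lee_fin powR_ge0.
  - apply/measurable_EFinP; rewrite {1}pq.
    under eq_fun do rewrite normc_powR quadE.
    apply: measurable_powR_comp; rewrite /sqn /plane.
    case: (\tr M) => x y /=.
    by apply: measurable_funD; apply: measurable_funX; exact: measurable_funD.
  - apply/measurable_EFinP/measurable_normpow/measurable_funD => //.
    by apply: measurable_funD; exact: mabs.
  - move=> w _; rewrite lee_fin; apply: ler_powRl; [lra|exact: normc_ge0|].
    rewrite ger0_norm ?addr_ge0// quadE (le_trans (le_normcD _ _))// addrC lerD2l.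
    exact: normc_le_ReIm.
apply: (le_trans H3).
have FE : frobenius_norm M `^ p = S `^ q by rewrite pq frobenius_powR.
have tE : t `^ p = (t ^+ 2) `^ q by rewrite -(normr_powR_sqr pq) ger0_norm.
have gE : gam `^ p = (gam ^+ 2) `^ q.
  by rewrite -(normr_powR_sqr pq) ger0_norm// (le_trans ler01).
rewrite alphaE -gamp FE tE gE -[X in (_ * (_ + X))%E]EFinM.
rewrite -[X in (_ * X)%E]EFinD -EFinM lee_fin.
have -> : 4 * (t ^+ 2 + 4 * (c + c)) = 4 * (t ^+ 2 + 8 * c) by ring.
rewrite cE -powRM ?sqr_ge0//.
set u := t ^+ 2; set v := gam ^+ 2 * S.
have u0 : 0 <= u by exact: sqr_ge0.
have v0 : 0 <= v by rewrite mulr_ge0// sqr_ge0.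
have Lv0 : 0 <= L * v by exact: mulr_ge0.
rewrite powRM ?addr_ge0//.
have -> : 8 `^ q = 4 `^ q * 2 `^ q :> R.
  by rewrite -powRM//; congr (_ `^ _); ring.
rewrite -2!(mulrA (4 `^ q)) -(mulrA (2 `^ q)) ler_wpM2l ?powR_ge0//.
apply: (le_trans (powR_addl q0 u0 Lv0)); rewrite ler_wpM2l ?powR_ge0//.
rewrite powRM//; have := powR_ge0 u q; have := powR_ge0 v q; have := powR_ge0 L q.
nra.
Qed.
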